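(* For every integer $r\ge 4$ and every sufficiently large $n$, there exist an $r$-element set $R\subseteq[n]$ and an $R_4$-sum-free set $M\subseteq[n]$ with $|M|>n^{1-o(1)}$ (the $o(1)$ term tending to $0$ as $n\to\infty$).
   Context: $[n]=\{1,\dots,n\}$. Let $R=\{b_1,\dots,b_r\}$ be a set of $r$ distinct nonnegative integers and $3\le L\le r$. A set $M$ of integers is $R_L$-sum-free if for every integer $l$ with $3\le l\le L$ and every choice of $l$ distinct elements $b_{j_1},\dots,b_{j_l}$ of $R$, the equation $(b_{j_2}-b_{j_1})m_1+(b_{j_3}-b_{j_2})m_2+\cdots+(b_{j_l}-b_{j_{l-1}})m_{l-1}+(b_{j_1}-b_{j_l})m_l=0$ has no solution with $m_1,\dots,m_l\in M$ except the trivial ones $m_1=m_2=\cdots=m_l$. *)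

(* Defs.v *)
From mathcomp Require Import all_boot all_order all_algebra finmap.
From mathcomp Require Import all_classical all_reals all_analysis.

Set Implicit Arguments.
Unset Strict Implicit.
Unset Printing Implicit Defensive.

Import Order.TTheory GRing.Theory Num.Theory.
Import numFieldNormedType.Exports.

Local Open Scope classical_set_scope.
Local Open Scope ring_scope.

(* [sum_free R L M]: the set of integers M is R_L-sum-free.  The l distinct
   elements of R are an injective family b_0, ..., b_(l-1); since [ordS] is the
   cyclic successor on ['I_l], the last summand is (b_0 - b_(l-1)) m_(l-1).
   The differences are taken in [int]. *)
Definition sum_free (R : {fset nat}) (L : nat) (M : set int) : Prop :=
  forall l : nat, (3 <= l <= L)%N ->
  forall b : 'I_l -> nat, injective b -> (forall j, b j \in R) ->
  forall m : 'I_l -> int, (forall j, M (m j)) ->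
    \sum_(j < l) ((b (ordS j))%:Z - (b j)%:Z) * m j = 0 ->
  forall i j, m i = m j.

(* Main.v *)
Require Import Defs.
From mathcomp Require Import all_boot all_order all_algebra finmap.
From mathcomp Require Import all_classical all_reals all_analysis.
From mathcomp Require Import zify ring lra.

Set Implicit Arguments.
Unset Strict Implicit.
Unset Printing Implicit Defensive.

Import Order.TTheory GRing.Theory Num.Theory.
Import numFieldNormedType.Exports.

Local Open Scope classical_set_scope.
Local Open Scope ring_scope.

(** The set [M] is first built in the polynomial ring [Z[T]] and then mapped to
    [Z] by evaluating [T] at a large base [B].  Its elements are the vectors of
    [K] polynomials of degree less than [k], with coefficients ("digits") in
    [1..d], whose sum of squares is a fixed polynomial [q]; by pigeonhole some
    [q] costs only a factor [d ^ O(k)] out of [d ^ (K k)].  The elements of [R]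
    are the values at [B] of fixed polynomials [beta_j], chosen so that each
    weak order of the index set is the order of the [beta_j(tau)] at some integer
    [tau].  Since [B] is a constant multiple of [d], multiplication by the
    [beta_j] produces no carries, and a relation
    [sum_c (b_(c+1) - b_c) m_c = 0] in [Z] lifts to [sum_c g_c p_c = 0] in
    [Z[T]].  At a [tau] where [beta_1 < ... < beta_l] only the last [g_c] is
    negative, so the relation is a convex combination of points of a sphere,
    and this forces the [p_c] to be equal.  The [beta_j] grow with [d], which is
    where the dependence of [R] on [n] enters; the relations with four terms
    that are not convex over [Z] are thereby covered. *)

(** * Integer polynomials with small coefficients *)

(** The constant coefficient is a multiple of [B] smaller than [B] in absolute value, so it
    vanishes; then a factor [B] cancels. *)
Lemma poly_eq0_of_small_coef (B : int) (p : {poly int}) :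
  (forall i, `|p`_i| < B) -> p.[B] = 0 -> p = 0.
Proof.
elim/poly_ind: p => [//|p c IHp] small.
have B0 : 0 < B by apply: le_lt_trans (small 0%N).
have cB : `|c| < B by have := small 0%N; rewrite coefD coefMX coefC /= add0r.
rewrite hornerMXaddC => /eqP; rewrite addr_eq0 => /eqP pc.
have c0 : c = 0.
  have p0 : p.[B] = 0.
    apply/eqP; apply: contraTT cB => p0.
    rewrite -leNgt -(opprK c) -pc normrN normrM (gtr0_norm B0).
    by rewrite (ler_peMl (ltW B0)) // -gtz0_ge1 normr_gt0.
  by apply/eqP; rewrite -oppr_eq0 -pc p0 mul0r.
rewrite c0 addr0 IHp ?mul0r // => [i|].
  by have := small i.+1; rewrite c0 addr0 coefMX.
by apply/eqP; move/eqP: pc; rewrite c0 oppr0 mulf_eq0 (gt_eqF B0) orbF.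
Qed.

Definition norm1 (p : {poly int}) : int := \sum_(i < size p) `|p`_i|.

Lemma norm1_ge0 (p : {poly int}) : 0 <= norm1 p.
Proof. by apply: sumr_ge0. Qed.

Lemma norm1E N (p : {poly int}) : (size p <= N)%N -> norm1 p = \sum_(i < N) `|p`_i|.
Proof.
move=> le_pN; rewrite /norm1 (big_ord_widen _ (fun i => `|p`_i|) le_pN).
rewrite big_mkcond; apply: eq_bigr => i _.
by case: ltnP => // /(nth_default 0) ->; rewrite normr0.
Qed.

Lemma sum_coef_le_norm1 N (p : {poly int}) : \sum_(i < N) `|p`_i| <= norm1 p.
Proof.
rewrite (norm1E (leq_maxl (size p) N)).
rewrite (big_ord_widen _ (fun i => `|p`_i|) (leq_maxr (size p) N)).
by rewrite big_mkcond; apply: ler_sum => i _; case: ifP.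
Qed.

Lemma norm_coef_le_norm1 (p : {poly int}) t : `|p`_t| <= norm1 p.
Proof.
by rewrite (le_trans _ (sum_coef_le_norm1 t.+1 p)) // big_ord_recr lerDr sumr_ge0.
Qed.

Lemma norm1B (p q : {poly int}) : norm1 (p - q) <= norm1 p + norm1 q.
Proof.
set N := maxn (size p) (size q).
have le_pqN : (size (p - q)%R <= N)%N.
  by rewrite (leq_trans (size_polyD _ _)) ?size_polyN.
rewrite (norm1E le_pqN) (@norm1E N p (leq_maxl _ _)).
rewrite (@norm1E N q (leq_maxr _ _)) -big_split /=.
by apply: ler_sum => i _; rewrite coefB ler_normB.
Qed.

Lemma norm_coefM_le (p q : {poly int}) (d : int) t :
  (forall i, `|q`_i| <= d) -> `|(p * q)`_t| <= norm1 p * d.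
Proof.
move=> qd; rewrite coefM (le_trans (ler_norm_sum _ _ _)) //.
apply: (@le_trans _ _ ((\sum_(i < t.+1) `|p`_i|) * d)).
  by rewrite mulr_suml; apply: ler_sum => i _; rewrite normrM ler_wpM2l.
by rewrite ler_wpM2r ?sum_coef_le_norm1 // (le_trans _ (qd 0%N)).
Qed.

Lemma norm_horner_le (p : {poly int}) (x : int) s :
  (size p <= s.+1)%N -> 1 <= x -> `|p.[x]| <= norm1 p * x ^+ s.
Proof.
move=> le_ps x1; have x0 : 0 <= x by apply: le_trans x1.
rewrite (horner_coef_wide _ le_ps) (norm1E le_ps) mulr_suml.
rewrite (le_trans (ler_norm_sum _ _ _)) //; apply: ler_sum => i _.
rewrite normrM normrX (ger0_norm x0) ler_wpM2l // ler_weXn2l //.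
by rewrite -ltnS.
Qed.

(** * Rigidity on a sphere over [Z[T]] *)

(* If [tau] is a root of every [h a], then divide all of them by ['X - tau]. *)
Lemma weighted_sum_sqr_eq0 (A : finType) (w h : A -> {poly int}) (tau : int) :
  (forall a, 0 < (w a).[tau]) -> \sum_a w a * h a ^+ 2 = 0 ->
  forall a, h a = 0.
Proof.
move=> w0; have [N] : exists N, forall a, (size (h a) <= N)%N.
  by exists (\max_a size (h a))%N => a; exact: (leq_bigmax a).
elim: N h => [|N IHN] h size_h sum0 a.
  by apply/eqP; rewrite -size_poly_leq0.
(* At [tau] the terms are nonnegative with sum zero and the weights are positive, so every [h b]
   vanishes there. *)
have root_h b : root (h b) tau.
  have : (\sum_a w a * h a ^+ 2).[tau] == 0 by rewrite sum0 horner0.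
  rewrite horner_sum psumr_eq0 => [/allP/(_ b)|c _]; last first.
    by rewrite hornerM horner_exp mulr_ge0 ?sqr_ge0 // ltW.
  rewrite mem_index_enum hornerM horner_exp mulf_eq0 (gt_eqF (w0 b)) /=.
  by rewrite sqrf_eq0 => /(_ isT).
have [h' hE] : {h' | forall b, h b = h' b * ('X - tau%:P)}.
  suff /choice[h' hE] : forall b, exists q, h b = q * ('X - tau%:P) by exists h'.
  by move=> b; apply/factor_theorem.
rewrite hE (IHN h') ?mul0r // => [b|].
  have [-> |h'b0] := eqVneq (h' b) 0; first by rewrite size_poly0.
  by have := size_h b; rewrite hE size_Mmonic ?monicXsubC // size_XsubC addn2.
have X0 : ('X - tau%:P) ^+ 2 != 0 by rewrite sqrf_eq0 polyXsubC_eq0.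
apply/eqP; rewrite -(mulIr_eq0 _ (mulIf X0)) mulr_suml.
by rewrite -[X in _ == X]sum0; apply/eqP/eq_bigr => b _; rewrite hE exprMn -mulrA.
Qed.

(* [sum_c g_c |p_c - p_c0|^2 = 0] since all [|p_c|^2] agree. *)
Lemma sphere_rigid (I C : finType) (c0 : C) (g : C -> {poly int})
    (p : C -> I -> {poly int}) (q : {poly int}) (tau : int) :
  (forall c, c != c0 -> 0 < (g c).[tau]) -> \sum_c g c = 0 ->
  (forall i, \sum_c g c * p c i = 0) -> (forall c, \sum_i p c i ^+ 2 = q) ->
  forall c i, p c i = p c0 i.
Proof.
move=> g0 sum_g sum_gp sphere c i.
(* The weight at [c0], where [g] may be negative, is replaced by 1; this is harmless since [h]
   vanishes there. *)
pose w (a : C * I) := if a.1 == c0 then 1 else g a.1.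
pose h (a : C * I) := p a.1 a.2 - p c0 a.2.
suff /(_ (c, i)) : forall a, h a = 0.
  by rewrite /h /= => /eqP; rewrite subr_eq0 => /eqP.
apply: (@weighted_sum_sqr_eq0 _ w h tau) => [[a j]|].
  by rewrite /w /=; have [_|/g0//] := eqVneq a c0; rewrite hornerC.
pose F c := g c * \sum_i (p c i - p c0 i) ^+ 2.
rewrite -(pair_bigA _ (fun c i => w (c, i) * h (c, i) ^+ 2)) /=.
transitivity (\sum_c F c).
  apply: eq_bigr => a _; rewrite /F mulr_sumr; apply: eq_bigr => j _.
  by rewrite /w /h /=; have [->|//] := eqVneq a c0; rewrite subrr expr0n !mulr0.
have FE c' : F c' = g c' * (q + q) - (\sum_i g c' * p c' i * p c0 i) *+ 2.
  rewrite /F (eq_bigr (fun i => p c' i ^+ 2 + p c0 i ^+ 2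
    - (p c' i * p c0 i) *+ 2)) => [|j _]; last by ring.
  rewrite sumrB big_split /= !sphere mulrBr; congr (_ - _).
  by rewrite sumrMnl mulrnAr mulr_sumr; congr (_ *+ _);
     apply: eq_bigr => j _; rewrite mulrA.
rewrite (eq_bigr _ (fun c' _ => FE c')) sumrB -mulr_suml sum_g mul0r sub0r.
rewrite sumrMnl exchange_big big1 ?mul0rn ?oppr0 // => j _.
by rewrite -mulr_suml sum_gp mul0r.
Qed.

(** * Polynomials realizing every weak order *)

(** Interpolation with one node [t w] for each [w]: [e w] is a product of squares, hence
    nonnegative, and vanishes at every node but its own. At [t w] the sum in [beta j] reduces to
    [w j] times a positive factor independent of [j]. *)
Lemma exists_order_polys (r L : nat) : exists beta : 'I_r -> {poly int},
  (forall j x, 1 <= (beta j).[x]) /\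
  forall w : {ffun 'I_r -> 'I_L}, exists tau : int,
    forall i j, (w i < w j)%N -> (beta i).[tau] < (beta j).[tau].
Proof.
pose t (w : {ffun 'I_r -> 'I_L}) : int := enum_rank w.
pose e w : {poly int} := \prod_(v | v != w) ('X - (t v)%:P) ^+ 2.
have eE w x : (e w).[x] = \prod_(v | v != w) (x - t v) ^+ 2.
  rewrite horner_prod; apply: eq_bigr => v _.
  by rewrite horner_exp hornerXsubC.
have e_ge0 w x : 0 <= (e w).[x].
  by rewrite eE; apply: prodr_ge0 => v _; rewrite sqr_ge0.
have e_gt0 w : 0 < (e w).[t w].
  rewrite eE; apply: prodr_gt0 => v vw.
  rewrite exprn_even_gt0 //= subr_eq0; apply: contraNneq vw => /eqP.
  by rewrite eqz_nat val_eqE (inj_eq enum_rank_inj) eq_sym.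
have e_eq0 w v : v != w -> (e v).[t w] = 0.
  by move=> vw; rewrite eE (bigD1 w) 1?eq_sym //= subrr expr0n mul0r.
exists (fun j => 1 + \sum_(w : {ffun 'I_r -> 'I_L}) (w j)%:Z *: e w).
have betaE j x : (1 + \sum_(w : {ffun 'I_r -> 'I_L}) (w j)%:Z *: e w).[x] =
    1 + \sum_(w : {ffun 'I_r -> 'I_L}) (w j)%:Z * (e w).[x].
  rewrite hornerD hornerC horner_sum; congr (_ + _).
  by apply: eq_bigr => w _; rewrite hornerZ.
split=> [j x|w].
  by rewrite betaE lerDl; apply: sumr_ge0 => w _; rewrite mulr_ge0.
exists (t w) => i j ltij; rewrite !betaE ltrD2l.
suff sumE a : \sum_(v : {ffun 'I_r -> 'I_L}) (v a)%:Z * (e v).[t w] =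
    (w a)%:Z * (e w).[t w].
  by rewrite !sumE ltr_pM2r // ltz_nat.
by rewrite (bigD1 w) //= big1 ?addr0 // => v vw; rewrite e_eq0 ?mulr0.
Qed.

(** * Encoding vectors of polynomials as integers *)

(** A two-level expansion: the values at [B] serve as digits in base [D]. *)
Definition block_code (K : nat) (B D : int) (p : 'I_K -> {poly int}) : int :=
  \sum_(i < K) (p i).[B] * D ^+ i.

(** [poly_eq0_of_small_coef] applies twice: in base [D] to the values at [B], then in base [B] to
    each polynomial. *)
Lemma block_code_eq0 (K : nat) (B D : int) (p : 'I_K -> {poly int}) :
  (forall i t, `|(p i)`_t| < B) -> (forall i, `|(p i).[B]| < D) ->
  block_code B D p = 0 -> forall i, p i = 0.
Proof.
move=> pB pD code0 i; apply: (@poly_eq0_of_small_coef B) => //.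
pose q := rVpoly (\row_j (p j).[B]).
have qE (j : 'I_K) : q`_j = (p j).[B] by rewrite coef_rVpoly_ord mxE.
rewrite -qE; suff -> : q = 0 by rewrite coef0.
apply: (@poly_eq0_of_small_coef D) => [t|].
  have [lt_tK|le_Kt] := ltnP t K; first by rewrite (qE (Ordinal lt_tK)).
  rewrite nth_default ?(leq_trans (size_poly _ _)) // normr0.
  exact: le_lt_trans (pD i).
rewrite (horner_coef_wide _ (size_poly _ _ : (size q <= K)%N)) -[RHS]code0.
by apply: eq_bigr => j _; rewrite qE.
Qed.

Lemma block_code_sum (C : finType) (K : nat) (B D : int) (g : C -> {poly int})
    (p : C -> 'I_K -> {poly int}) :
  block_code B D (fun i => \sum_c g c * p c i) =
  \sum_c (g c).[B] * block_code B D (p c).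
Proof.
under [RHS]eq_bigr do rewrite mulr_sumr.
rewrite exchange_big; apply: eq_bigr => i _ /=.
rewrite horner_sum mulr_suml; apply: eq_bigr => c _.
by rewrite hornerM mulrA.
Qed.

Lemma block_codeB (K : nat) (B D : int) (p q : 'I_K -> {poly int}) :
  block_code B D (fun i => p i - q i) = block_code B D p - block_code B D q.
Proof. by rewrite -sumrB; apply: eq_bigr => i _; rewrite hornerD hornerN mulrBl. Qed.

Lemma block_code_lt (K : nat) (B D : int) (p : 'I_K -> {poly int}) :
  0 <= D -> (forall i, (p i).[B] < D) -> block_code B D p < D ^+ K.
Proof.
move=> D0; elim: K p => [|K IHK] p pD; first by rewrite /block_code big_ord0.
rewrite /block_code big_ord_recr /= exprSr.
have := IHK (fun i => p (widen_ord (leqnSn K) i)) (fun i => pD _).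
have /ler_wpM2r : (p ord_max).[B] <= D - 1 by rewrite -ltzD1 subrK.
move=> /(_ _ (exprn_ge0 K D0)); rewrite mulrBl mul1r /block_code /=.
move=> le_top lt_low.
by rewrite (lt_le_trans (ltr_leD lt_low le_top)) // addrC subrK mulrC.
Qed.

Lemma block_code_gt0 (K : nat) (B D : int) (p : 'I_K -> {poly int}) :
  (0 < K)%N -> 0 < D -> (forall i, 0 < (p i).[B]) -> 0 < block_code B D p.
Proof.
case: K p => // K p _ D0 p0; rewrite /block_code (bigD1 ord0) //=.
rewrite ltr_wpDr ?mulr_gt0 ?exprn_gt0 //; apply: sumr_ge0 => i _.
by rewrite mulr_ge0 ?exprn_ge0 ?ltW.
Qed.

(** * Digit vectors and the pigeonhole argument *)

(** Digits run from 1 to [d] rather than from 0, which makes the codes positive. *)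
Definition digit_poly (d k K : nat) (x : {ffun 'I_K * 'I_k -> 'I_d})
  (i : 'I_K) : {poly int} := rVpoly (\row_(j < k) (x (i, j)).+1%:Z).

Lemma size_digit_poly (d k K : nat) (x : {ffun 'I_K * 'I_k -> 'I_d})
    (i : 'I_K) :
  (size (digit_poly x i) <= k)%N.
Proof. exact: size_poly. Qed.

Lemma coef_digit_poly_ord (d k K : nat) (x : {ffun 'I_K * 'I_k -> 'I_d})
    (i : 'I_K) (j : 'I_k) :
  (digit_poly x i)`_j = (x (i, j)).+1%:Z.
Proof. by rewrite coef_rVpoly_ord mxE. Qed.

Lemma coef_digit_poly_bound (d k K : nat) (x : {ffun 'I_K * 'I_k -> 'I_d})
    (i : 'I_K) t :
  0 <= (digit_poly x i)`_t <= d%:Z.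
Proof.
have [lt_tk|le_kt] := ltnP t k.
  by rewrite (coef_digit_poly_ord _ _ (Ordinal lt_tk)) lez_nat; exact: ltn_ord.
by rewrite nth_default ?lexx // (leq_trans (size_digit_poly _ _)).
Qed.

Lemma norm1_digit_poly (d k K : nat) (x : {ffun 'I_K * 'I_k -> 'I_d})
    (i : 'I_K) :
  norm1 (digit_poly x i) <= k%:Z * d%:Z.
Proof.
rewrite (norm1E (size_digit_poly _ _)).
rewrite (@le_trans _ _ (\sum_(j < k) d%:Z)) ?ler_sum // => [j _|].
  by have /andP[c0 cd] := coef_digit_poly_bound x i j; rewrite ger0_norm.
by rewrite sumr_const card_ord -mulr_natl natz.
Qed.


Lemma digit_poly_inj (d k K : nat) (x y : {ffun 'I_K * 'I_k -> 'I_d}) :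
  (forall i, digit_poly x i = digit_poly y i) -> x = y.
Proof.
move=> eq_xy; apply/ffunP => -[i j]; apply/val_inj.
have := congr1 (fun p : {poly int} => p`_j) (eq_xy i).
by rewrite !coef_digit_poly_ord => -[].
Qed.

(** Pigeonhole on the most frequent value; [y0] witnesses that [Y] is nonempty. *)
Lemma exists_large_fiber (X Y : finType) (f : X -> Y) (y0 : Y) :
  exists y, (#|X| <= #|[pred x | f x == y]| * #|Y|)%N.
Proof.
pose F y := #|[pred x | f x == y]|.
exists [arg max_(y > y0) F y]%N; case: arg_maxnP => // y _ maxy.
rewrite -sum1_card (partition_big f xpredT) //= mulnC -sum_nat_const.
apply: leq_sum => z _; rewrite (leq_trans _ (maxy z isT)) //.
by rewrite /F -sum1_card; apply/eq_leq/eq_bigl => a; rewrite !inE.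
Qed.

Definition sqr_sum (d k K : nat) (x : {ffun 'I_K * 'I_k -> 'I_d}) : {poly int} :=
  \sum_i digit_poly x i ^+ 2.

Lemma size_sqr_sum (d k K : nat) (x : {ffun 'I_K * 'I_k -> 'I_d}) :
  (size (sqr_sum x) <= 2 * k)%N.
Proof.
rewrite (leq_trans (size_sum _ _ _)) //; apply/bigmax_leqP => i _.
rewrite (leq_trans (size_polyMleq _ _)) // (leq_trans (leq_pred _)) //.
by rewrite mul2n -addnn leq_add ?size_digit_poly.
Qed.

Lemma coef_sqr_sum (d k K : nat) (x : {ffun 'I_K * 'I_k -> 'I_d}) t :
  0 <= (sqr_sum x)`_t <= (K * (k * d * d))%:Z.
Proof.
rewrite coef_sum; apply/andP; split.
  apply: sumr_ge0 => i _; rewrite coefM; apply: sumr_ge0 => j _.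
  by rewrite mulr_ge0 //; have /andP[] := coef_digit_poly_bound x i j;
     have /andP[] := coef_digit_poly_bound x i (t - j)%N.
rewrite (@le_trans _ _ (\sum_(i < K) (k * d * d)%:Z)) //; last first.
  by rewrite sumr_const card_ord -mulr_natl natz -PoszM.
apply: ler_sum => i _; rewrite (le_trans (ler_norm _)) //.
rewrite (le_trans (norm_coefM_le (d := d%:Z) _ _ _)) // => [j|].
  by have /andP[c0 cd] := coef_digit_poly_bound x i j; rewrite ger0_norm.
by rewrite PoszM ler_wpM2r // PoszM norm1_digit_poly.
Qed.

Lemma exists_large_sphere (d k K : nat) : exists q : {poly int},
  (d ^ (K * k) <=
   #|[pred x : {ffun 'I_K * 'I_k -> 'I_d} | sqr_sum x == q]| *
   (K * (k * d * d)).+1 ^ (2 * k))%N.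
Proof.
set W := (K * (k * d * d))%N.
(* The sphere is determined by [2 * k] coefficients, each in [0..W], so [inord] loses nothing. *)
pose f (x : {ffun 'I_K * 'I_k -> 'I_d}) :=
  [ffun l : 'I_(2 * k) => inord (absz (sqr_sum x)`_l) : 'I_W.+1].
have [y] := exists_large_fiber f [ffun=> ord0].
rewrite !card_ffun card_prod !card_ord => le_card.
have [x0 /eqP fx0|F0] := pickP [pred x | f x == y]; last first.
  by exists 0; rewrite (leq_trans le_card) // (eq_card0 F0).
exists (sqr_sum x0); rewrite (leq_trans le_card) // leq_mul2r.
rewrite subset_leq_card ?orbT //.
apply/fintype.subsetP => x; rewrite !inE -fx0 => /eqP/ffunP eq_f.
apply/eqP/polyP => t; have [lt_tk|le_kt] := ltnP t (2 * k)%N; last first.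
  by rewrite !nth_default ?(leq_trans (size_sqr_sum _)).
have := congr1 val (eq_f (Ordinal lt_tk)); rewrite !ffunE /=.
have /andP[a0 aW] := coef_sqr_sum x t; have /andP[b0 bW] := coef_sqr_sum x0 t.
rewrite !inordK ?ltnS -?lez_nat ?gez0_abs // => eq_abs.
by rewrite -(gez0_abs a0) -(gez0_abs b0) eq_abs.
Qed.

Lemma horner_digit_poly (d k K : nat) (x : {ffun 'I_K * 'I_k.+1 -> 'I_d})
    (i : 'I_K) (B : int) :
  1 <= B -> 0 < (digit_poly x i).[B] <= k.+1%:Z * d%:Z * B ^+ k.
Proof.
move=> B1; have B0 : 0 <= B by exact: le_trans B1.
have coef_ge0 t : 0 <= (digit_poly x i)`_t.
  by have /andP[] := coef_digit_poly_bound x i t.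
apply/andP; split.
  rewrite (horner_coef_wide _ (size_digit_poly x i)) big_ord_recl expr0 mulr1.
  rewrite (coef_digit_poly_ord x i ord0) ltr_wpDr ?ltz_nat //.
  by apply: sumr_ge0 => j _; rewrite mulr_ge0 ?exprn_ge0.
rewrite (le_trans (ler_norm _)) //.
rewrite (le_trans (norm_horner_le (size_digit_poly x i) B1)) //.
by rewrite ler_wpM2r ?exprn_ge0 ?norm1_digit_poly.
Qed.

Lemma block_code_digit_poly_inj (d k K : nat) (B D : int) :
  1 <= B -> d%:Z < B -> k.+1%:Z * d%:Z * B ^+ k < D ->
  injective (fun x : {ffun 'I_K * 'I_k.+1 -> 'I_d} =>
    block_code B D (digit_poly x)).
Proof.
move=> B1 dB kdD x y /eqP; rewrite -subr_eq0 -block_codeB => /eqP code0.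
apply: digit_poly_inj => i; apply/eqP; rewrite -subr_eq0; apply/eqP.
move: i; apply: (block_code_eq0 _ _ code0) => [i t|i].
  have /andP[a0 aB] := coef_digit_poly_bound x i t.
  have /andP[b0 bB] := coef_digit_poly_bound y i t.
  by rewrite coefB ltr_norml; apply/andP; split; lra.
rewrite hornerD hornerN.
have /andP[a0 aB] := horner_digit_poly x i B1.
have /andP[b0 bB] := horner_digit_poly y i B1.
by rewrite ltr_norml; apply/andP; split; lra.
Qed.

(** * Lifting relations without carries *)

Lemma sum_cyclic_diff (l : nat) (V : zmodType) (f : 'I_l -> V) :
  \sum_(j < l) (f (ordS j) - f j) = 0.
Proof.
apply/eqP; rewrite sumrB subr_eq0; apply/eqP; symmetry.
by apply: reindex; apply/onW_bij/ordS_bij.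
Qed.

(* The weights [g c] sum to [0] and only [g c0] is negative, so the relation
   in [Z[T]] is a convex combination of points of a sphere. *)
Lemma block_code_rigid (C : finType) (c0 : C) (d k s K : nat) (A B tau : int)
    (g : C -> {poly int}) (x : C -> {ffun 'I_K * 'I_k.+1 -> 'I_d}) q :
  1 <= B -> #|C|%:Z * A * (k.+1%:Z * d%:Z) < B ->
  (forall c, norm1 (g c) <= A) -> (forall c, (size (g c) <= s.+1)%N) ->
  (forall c, c != c0 -> 0 < (g c).[tau]) -> \sum_c g c = 0 ->
  (forall c, sqr_sum (x c) = q) ->
  \sum_c (g c).[B] * block_code B (B ^+ (k.+1 + s)) (digit_poly (x c)) = 0 ->
  forall c, x c = x c0.
Proof.
move=> B1 CAB gA gs g0 sum_g sphere; rewrite -block_code_sum => code0 c.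
have B0 : 0 < B by exact: lt_le_trans B1.
have A0 : 0 <= A by apply: le_trans (gA c); exact: norm1_ge0.
have kd0 : 0 <= k.+1%:Z * d%:Z by rewrite mulr_ge0.
apply: digit_poly_inj; move: c; apply: (sphere_rigid (q := q) g0 sum_g) =>
  [|c]; last exact: sphere.
apply: (block_code_eq0 _ _ code0) => [i t|i].
  rewrite coef_sum (le_lt_trans (ler_norm_sum _ _ _)) //.
  rewrite (le_lt_trans _ CAB) // -mulrA -[#|C|%:Z]natz mulr_natl -sumr_const.
  apply: ler_sum => c _; rewrite (le_trans (norm_coefM_le (d := d%:Z) _ _ _)) //.
    by move=> j; have /andP[a0 aB] := coef_digit_poly_bound (x c) i j;
       rewrite ger0_norm.
  rewrite ler_pM ?norm1_ge0 //; lia.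
(* One factor [B] of [B ^+ (k.+1 + s)] absorbs the constants; [B ^+ k] and [B ^+ s] account for the
   degrees of the digit polynomials and of the [g c]. *)
rewrite horner_sum (le_lt_trans (ler_norm_sum _ _ _)) //.
rewrite addSn exprS exprD [ltRHS]mulrC -mulrA.
apply: (@le_lt_trans _ _ (#|C|%:Z * A * (k.+1%:Z * d%:Z) * (B ^+ k * B ^+ s))).
  rewrite -!mulrA -[#|C|%:Z]natz mulr_natl -sumr_const; apply: ler_sum => c _.
  rewrite hornerM normrM.
  have /andP[p0 pB] := horner_digit_poly (x c) i B1.
  rewrite (@le_trans _ _ ((A * B ^+ s) * (k.+1%:Z * d%:Z * B ^+ k))) //.
    rewrite ler_pM // ?(ger0_norm (ltW p0)) //.
    rewrite (le_trans (norm_horner_le (gs c) B1)) //.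
    by rewrite ler_wpM2r ?exprn_ge0 ?(ltW B0).
  by rewrite le_eqVlt; apply/orP; left; apply/eqP; ring.
rewrite [ltRHS]mulrA [ltRHS]mulrC.
by rewrite ltr_pM2r // mulr_gt0 ?exprn_gt0.
Qed.


(** * The construction for given parameters *)

(** [C] and [s] depend only on [r] and [L], so [k], [K] and [d] remain free to be tuned to [n]. *)
Lemma exists_sum_free (r L : nat) : (1 < L)%N ->
  exists C s : nat, (0 < C)%N /\ forall k K d, (0 < K)%N -> (0 < d)%N ->
    let N := ((C * (k.+1 * d)) ^ ((k.+1 + s) * K))%N in
    exists (R : {fset nat}) (M : {fset int}),
      [/\ #|` R|%fset = r,
          forall b : nat, b \in R -> (1 <= b <= N)%N,
          forall m : int, m \in M -> 1 <= m <= N%:Z,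
          sum_free R L [set` M]
        & (d ^ (K * k.+1) <=
           #|` M|%fset * (K * (k.+1 * d * d)).+1 ^ (2 * k.+1))%N].
Proof.
move=> L1; have [beta [beta_ge1 beta_order]] := exists_order_polys r L.
pose A : nat := (\sum_j absz (norm1 (beta j)))%N.
pose s : nat := (\max_j size (beta j))%N.
have beta_A j : norm1 (beta j) <= A.
  rewrite -(gez0_abs (norm1_ge0 (beta j))) lez_nat.
  by rewrite /A (bigD1 j) //= leq_addr.
have beta_s j : (size (beta j) <= s.+1)%N.
  by rewrite (leq_trans _ (leqnSn s)) //; exact: (leq_bigmax j).
(* This constant puts [B] above [2 * A], which separates the [beta j], above [k.+1 * d], which makes
   the code injective, and above [L * (2 * A) * (k.+1 * d)], which prevents carries; [2 * A] bounds
   [norm1] of a difference. *)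
exists (L.+1 * (2 * A) + 2)%N, s; split=> [|k K d K0 d0 N]; first by rewrite addn2.
set B : nat := ((L.+1 * (2 * A) + 2) * (k.+1 * d))%N in N *.
have kd0 : (0 < k.+1 * d)%N by rewrite muln_gt0.
have kdB : (k.+1 * d < B)%N.
  by rewrite /B mulnDl addnC mul2n -addnn -addnA -[ltnLHS]addn0 ltn_add2l
             addn_gt0 kd0.
have AB : (2 * A < B)%N.
  rewrite /B; apply: (@leq_trans (L.+1 * (2 * A) + 2)); last by rewrite leq_pmulr.
  by rewrite mulSn -addnA -[ltnLHS]addn0 ltn_add2l addnS.
have LAB : (L * (2 * A) * (k.+1 * d) < B)%N.
  rewrite /B ltn_mul2r kd0 mulSn -addnA [(2 * A + _)%N]addnC -addnA.
  by rewrite -[ltnLHS]addn0 ltn_add2l.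
have B0 : (0 < B)%N by exact: leq_ltn_trans kdB.
have B1 : 1 <= B%:Z by rewrite lez_nat.
pose D : int := B%:Z ^+ (k.+1 + s).
have D0 : 0 < D by rewrite exprn_gt0.
have DN : D ^+ K = N%:Z by rewrite /N -exprM -[RHS]natz natrX natz.
have kdD : k.+1%:Z * d%:Z * B%:Z ^+ k < D.
  rewrite /D addSn exprS exprD mulrA.
  rewrite (@lt_le_trans _ _ (B%:Z * B%:Z ^+ k)) ?ltr_pM2r ?exprn_gt0 //.
  by rewrite ler_peMr ?exprn_ege1 // mulr_ge0 ?exprn_ge0.
have [q le_q] := exists_large_sphere d k.+1 K.
pose X := [pred x : {ffun 'I_K * 'I_k.+1 -> 'I_d} | sqr_sum x == q].
pose cd (x : {ffun 'I_K * 'I_k.+1 -> 'I_d}) := block_code B D (digit_poly x).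
have cd_inj : injective cd.
  by apply: block_code_digit_poly_inj => //;
     rewrite ltz_nat (leq_ltn_trans _ kdB) // leq_pmull.
pose val j := absz (beta j).[B%:Z].
have valE j : (val j)%:Z = (beta j).[B%:Z].
  by rewrite gez0_abs // (le_trans _ (beta_ge1 j _)).
exists [fset b in [seq val j | j <- enum 'I_r]]%fset.
exists [fset m in [seq cd x | x <- enum X]]%fset.
have val_inj : injective val.
  move=> i j /(congr1 Posz); rewrite !valE => /eqP.
  rewrite -subr_eq0 -hornerN -hornerD => /eqP eqB.
  have eq_beta : beta i - beta j = 0.
    apply: (poly_eq0_of_small_coef _ eqB) => t.
    rewrite coefB (le_lt_trans (ler_normB _ _)) //.
    apply: (@le_lt_trans _ _ (A%:Z + A%:Z)); last by rewrite -PoszD addnn -mul2n.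
    by rewrite lerD // (le_trans (norm_coef_le_norm1 _ _)).
  have [//|ij] := eqVneq i j.
  (* Equal polynomials contradict a weak order putting [i] below [j], available because [L] is at
     least 2. *)
  case: L L1 beta_order
    {LAB B kdB AB B0 B1 D D0 DN kdD N q le_q X cd cd_inj val valE eqB}
    => [|[|L]] // _ /(_ [ffun a => if a == j then ord_max else ord0])[tau].
  move=> /(_ i j); rewrite !ffunE eqxx (negPf ij) => /(_ isT).
  by move/eqP: eq_beta; rewrite subr_eq0 => /eqP ->; rewrite ltxx.
have uniqR : uniq [seq val j | j <- enum 'I_r].
  by rewrite map_inj_uniq ?enum_uniq.
have uniqM : uniq [seq cd x | x <- enum X] by rewrite map_inj_uniq ?enum_uniq.
split.
- by rewrite card_fseq undup_id // size_map size_enum_ord.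
- move=> b; rewrite !inE => /mapP[j _ ->]; rewrite -!lez_nat valE beta_ge1 /=.
  rewrite -DN (le_trans (ler_norm _)) //.
  rewrite (le_trans (norm_horner_le (beta_s j) B1)) //.
  apply: (@le_trans _ _ (B%:Z ^+ s.+1)).
    rewrite exprS ler_wpM2r ?exprn_ge0 // (le_trans (beta_A j)) // lez_nat.
    by rewrite (leq_trans _ (ltnW AB)) // leq_pmull.
  rewrite -exprM ler_weXn2l // (leq_trans _ (leq_pmulr _ K0)) //.
  by rewrite addSn ltnS leq_addl.
- move=> m; rewrite !inE => /mapP[x _ ->].
  have xB i := horner_digit_poly x i B1.
  rewrite -DN -gtz0_ge1 block_code_gt0 // => [|i]; last by have /andP[] := xB i.
  rewrite ltW // block_code_lt ?ltW // => i.
  by have /andP[_ /le_lt_trans->] := xB i.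
- case=> // l /andP[_ lL] b b_inj bR m mM sum0.
  have /choice[g gE] : forall j, exists i, b j = val i.
    by move=> j; have := bR j; rewrite !inE => /mapP[i _ ->]; exists i.
  have /choice[x xE] : forall j, exists x, sqr_sum x = q /\ m j = cd x.
    move=> j; have := mM j; rewrite /= !inE => /mapP[x].
    by rewrite mem_enum => /eqP xq ->; exists x.
  have g_inj : injective g by move=> i j gij; apply: b_inj; rewrite !gE gij.
  (* The chosen elements are ranked in the order of the relation; other indices get the default 0.
     At the matching [tau] every [G c] is positive except at [ord_max], where [ordS] wraps
     around. *)
  pose w : {ffun 'I_r -> 'I_L} := [ffun a =>
    if [pick j | g j == a] is Some j then widen_ord lL j else Ordinal (ltnW L1)].
  have wE j : w (g j) = widen_ord lL j.
    rewrite ffunE; case: pickP => [j' /eqP/g_inj-> //|/(_ j)].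
    by rewrite eqxx.
  have [tau tauP] := beta_order w.
  pose G c := beta (g (ordS c)) - beta (g c).
  suff rigid i : x i = x ord_max by move=> i j; rewrite !(xE _).2 !rigid.
  apply: (@block_code_rigid _ ord_max d k s K (2 * A)%N B tau G x q) => //.
  + rewrite card_ord -!PoszM ltz_nat (leq_ltn_trans _ LAB) //.
    by rewrite leq_mul2r leq_mul2r lL !orbT.
  + move=> c; rewrite (le_trans (norm1B _ _)) // mul2n -addnn PoszD.
    by rewrite lerD.
  + move=> c; rewrite (leq_trans (size_polyD _ _)) // size_polyN geq_max.
    by rewrite !beta_s.
  + move=> c c_max; rewrite hornerD hornerN subr_gt0; apply: tauP.
    rewrite !wE /= modn_small // ltnS ltn_neqAle -ltnS ltn_ord andbT.
    by apply: contraNneq c_max => cl; apply/eqP/ord_inj.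
  + exact: sum_cyclic_diff.
  + by move=> c; have [] := xE c.
  + rewrite -[RHS]sum0; apply: eq_bigr => c _.
    by rewrite hornerD hornerN !gE !valE (xE c).2.
- rewrite card_fseq undup_id // size_map -cardE.
  exact: le_q.
Qed.

(** * Choice of parameters for given [n] *)

Lemma leq_expn (m n e : nat) : (m <= n)%N -> (m ^ e <= n ^ e)%N.
Proof. by case: e => // e le_mn; rewrite leq_exp2r. Qed.

(** Up to constants [n] is [d^E] and [|M|] is at least [d^(K(k+1) - 4(k+1))]; large [K] and [k]
    bring the ratio of exponents above [q/(q+1)], and a large [d] beats the constants. *)
Lemma exists_dense_sum_free (r L q : nat) : (1 < L)%N ->
  exists n0, forall n, (n0 <= n)%N ->
    exists (R : {fset nat}) (M : {fset int}),
      [/\ #|` R|%fset = r,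
          forall b : nat, b \in R -> (1 <= b <= n)%N,
          forall m : int, m \in M -> 1 <= m <= n%:Z,
          sum_free R L [set` M]
        & (n ^ q < #|` M|%fset ^ q.+1)%N].
Proof.
move=> L1; have [C [s [C0 construction]]] := exists_sum_free r L1.
(* In [exponents], [K(k+1)] must cover [Kqs + 1 + 4(k+1)(q+1)]. This [K] makes the last term half of
   [K(k+1)], and this [k] fits the rest into the other half. *)
pose K := (8 * q.+1)%N; pose k := (2 * q.+1 * s.+1).-1.
have kE : k.+1 = (2 * q.+1 * s.+1)%N by rewrite prednK ?muln_gt0.
pose E := ((k.+1 + s) * K)%N; pose c := (C * k.+1)%N.
pose a := ((2 * K * k.+1) ^ (2 * k.+1))%N.
pose Z := (a ^ q.+1 * (2 * c) ^ (E * q))%N.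
have K0 : (0 < K)%N by rewrite muln_gt0.
have E0 : (0 < E)%N by rewrite muln_gt0 addSn.
have c0 : (0 < c)%N by rewrite muln_gt0 C0.
have exponents : (E * q + 1 + 4 * k.+1 * q.+1 <= K * k.+1 * q.+1)%N.
  by rewrite /E /K kE; nia.
(* [Z] collects all constants; this threshold makes [Z.+1] an admissible [d], so the maximal [d]
   exceeds [Z]. *)
exists ((c * Z.+1) ^ E)%N => n le_n.
have ex_d : exists d, ((c * d) ^ E <= n)%N by exists Z.+1.
have bound_d d : ((c * d) ^ E <= n)%N -> (d <= n)%N.
  apply: leq_trans; rewrite (leq_trans (leq_pmull d c0)) //.
  by case: (c * d)%N => // m; rewrite -[leqLHS]expn1 leq_pexp2l.
case: (ex_maxnP ex_d bound_d) => d le_dn max_d.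
have lt_Zd : (Z < d)%N by exact: max_d.
have d0 : (0 < d)%N by exact: leq_ltn_trans lt_Zd.
have lt_n : (n < (c * d.+1) ^ E)%N.
  by rewrite ltnNge; apply/negP => /max_d; rewrite ltnn.
have [R [M [cardR boundR boundM free cardM]]] := construction k K d K0 d0.
have le_Nn : ((C * (k.+1 * d)) ^ ((k.+1 + s) * K) <= n)%N by rewrite mulnA.
exists R, M; split=> // [b /boundR/andP[-> /leq_trans->]//||].
  by move=> m /boundM/andP[-> /le_trans->] //; rewrite lez_nat.
(* By maximality [n < (c(d+1))^E], and [d + 1 <= 2d] costs only a constant factor. *)
have le_nq : (n ^ q <= (2 * c) ^ (E * q) * d ^ (E * q))%N.
  rewrite -expnMn expnM leq_expn // (leq_trans (ltnW lt_n)) // leq_expn //.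
  by rewrite [(2 * c)%N]mulnC -mulnA leq_mul2l mul2n -addnn -addn1 leq_add2l
             d0 orbT.
have le_dM : (d ^ (K * k.+1 * q.+1) <=
    #|` M|%fset ^ q.+1 * (a ^ q.+1 * d ^ (4 * k.+1 * q.+1)))%N.
  rewrite expnM [(d ^ (_ * q.+1))%N]expnM -!expnMn leq_expn //.
  rewrite (leq_trans cardM) // leq_mul2l; apply/orP; right.
  have -> : (4 * k.+1 = 2 * (2 * k.+1))%N by rewrite mulnA.
  rewrite [(d ^ _)%N]expnM -expnMn leq_expn //.
  rewrite -!mulnA mulnn mul2n -addnn -addn1 leq_add2l.
  by rewrite !muln_gt0 d0.
rewrite ltnNge; apply/negP => /leq_trans/(_ le_nq) le_M.
suff : (d ^ (E * q + 1 + 4 * k.+1 * q.+1) <=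
    Z * d ^ (E * q + 4 * k.+1 * q.+1))%N.
  rewrite addnAC addn1 expnS leq_pmul2r ?expn_gt0 ?d0 // leqNgt.
  by rewrite lt_Zd.
rewrite (leq_trans (leq_pexp2l d0 exponents)) // (leq_trans le_dM) //.
rewrite (leq_trans (leq_mul le_M (leqnn _))) // /Z expnD.
by apply/eq_leq; ring.
Qed.

(** * Real exponents and the [o(1)] term *)

(** Raising to the power [q + 1] turns the exponent [1 - 1/(q+1)] into [q]. *)
Lemma powR_lt_of_expn_lt (K : realType) (n m q : nat) :
  (n ^ q < m ^ q.+1)%N -> n%:R `^ (1 - q.+1%:R^-1) < m%:R :> K.
Proof.
move=> lt_nm; rewrite ltNge; apply/negP => le_mn.
have : (m%:R ^+ q.+1 : K) <= (n%:R `^ (1 - q.+1%:R^-1)) ^+ q.+1.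
  by rewrite lerXn2r ?nnegrE ?powR_ge0.
rewrite -[leRHS]powR_mulrn ?powR_ge0 // -powRrM.
have -> : (1 - q.+1%:R^-1) * q.+1%:R = q%:R :> K.
  by rewrite mulrBl mul1r mulVf ?pnatr_eq0 // mulrSr addrK.
by rewrite powR_mulrn // -!natrX ler_nat leqNgt lt_nm.
Qed.

Theorem theorem9 (K : realType) (r : nat) (hr : (4 <= r)%N) :
  exists eps : nat -> K, (eps @ \oo --> (0 : K)) /\
    \forall n \near \oo,
      exists (R : {fset nat}) (M : {fset int}),
        [/\ #|` R|%fset = r,
            forall b : nat, b \in R -> (1 <= b <= n)%N,
            forall m : int, m \in M -> 1 <= m <= n%:Z,
            sum_free R 4 [set` M]
          & n%:R `^ (1 - eps n) < (#|` M|%fset)%:R].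
Proof.
pose P n q := exists (R : {fset nat}) (M : {fset int}),
  [/\ #|` R|%fset = r, forall b : nat, b \in R -> (1 <= b <= n)%N,
      forall m : int, m \in M -> 1 <= m <= n%:Z, sum_free R 4 [set` M]
    & (n ^ q < #|` M|%fset ^ q.+1)%N].
have P_large q : exists n0, forall n, (n0 <= n)%N -> P n q.
  exact: exists_dense_sum_free.
(* The best [q] for this [n], capped by [n] to keep the maximum finite. *)
pose Q n := (\max_(q < n.+1 | `[< P n q >]) q)%N.
exists (fun n => (Q n).+1%:R^-1); split.
  (* Each [q] is admissible for all large [n], so [Q n] tends to infinity. *)
  apply/cvgr0Pnorm_lt => e e0.
  have [q _ /(_ q (leqnn q)) /= lt_qe] := near_infty_natSinv_lt (PosNum e0).
  have [n0 Pn0] := P_large q; exists (maxn n0 q) => //= n.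
  rewrite /= geq_max => /andP[le_n0 le_q].
  rewrite ger0_norm // (le_lt_trans _ lt_qe) // lef_pV2 ?posrE // ler_nat ltnS.
  apply: (@leq_bigmax_cond _ _ (fun q : 'I_n.+1 => nat_of_ord q)
    (Ordinal (le_q : q < n.+1)%N)).
  by apply/asboolP/Pn0.
(* The case [q = 0] makes the maximum range over a nonempty set, so it is attained. *)
have [n0 Pn0] := P_large 0%N; exists n0 => //= n /Pn0 Pn.
have [|q /asboolP [R [M [cardR boundR boundM free lt_nM]]] QE] :=
  @eq_bigmax_cond _ [pred q : 'I_n.+1 | `[< P n q >]]
    (fun q : 'I_n.+1 => nat_of_ord q).
  by apply/card_gt0P; exists ord0; apply/asboolP.
exists R, M; split => //.
by rewrite /Q QE; apply: powR_lt_of_expn_lt.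
Qed.
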